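(* For each nonnegative integer $k$, as $n \to \infty$, $$F(n,k) \sim \frac{1}{k!}\binom{k}{\lceil k/2\rceil}\, n^k = \frac{1}{\lceil k/2\rceil!\,\lfloor k/2\rfloor!}\, n^k,$$ where $\sim$ means that the ratio of the two sides tends to $1$ as $n\to\infty$ with $k$ fixed.
   Context: A column is an infinite vertical stack of cells (with a bottom cell, and unbounded upward), and a board is a finite sequence of columns (so the columns are distinguishable). A position on a board is a placement of finitely many tokens in cells such that each token is either red or yellow, no two tokens occupy the same cell, and the occupied cells in each column form a contiguous block starting from the bottom. Equivalently, a position on an $n$-column board is an $n$-tuple of finite words over $\{R,Y\}$, each column being read from bottom to top. A reachable position is one that can be obtained from the empty board by a finite sequence of moves, where each move inserts a token into the lowest empty cell of some column, and the inserted tokens alternate globally between red and yellow from move to move, the first move placing a red token. There is no win condition. $F(n,k)$ denotes the number of positions on an $n$-column board that are reachable in exactly $k$ moves. *)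

(* Defs.v *)
From HB Require Import structures.
From mathcomp Require Import all_boot all_order all_algebra finmap.
From mathcomp Require Import all_classical all_reals all_analysis.

Set Implicit Arguments.
Unset Strict Implicit.
Unset Printing Implicit Defensive.

Local Open Scope classical_set_scope.

Inductive color := Red | Yellow.

Definition is_red (c : color) : bool := if c is Red then true else false.

Definition color_of_bool (b : bool) : color := if b then Red else Yellow.

Lemma is_redK : cancel is_red color_of_bool.
Proof. by case. Qed.

HB.instance Definition _ := Countable.copy color (can_type is_redK).

(* Each column is the word of its tokens, read from bottom to top. *)
Definition position (n : nat) : choiceType := {ffun 'I_n -> seq color}.

Definition empty_board (n : nat) : position n := [ffun=> [::]].

Definition insert (n : nat) (c : color) (j : 'I_n) (p : position n) :
    position n :=
  [ffun i => if i == j then rcons (p i) c else p i].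

(* Color of the move made after m earlier moves. *)
Definition move_color (m : nat) : color := if odd m then Yellow else Red.

Inductive reachable (n : nat) : nat -> position n -> Prop :=
| reachable_start : reachable 0 (empty_board n)
| reachable_move (m : nat) (p : position n) (j : 'I_n) :
    reachable m p -> reachable m.+1 (insert (move_color m) j p).

Lemma finite_reachable (n k : nat) :
  finite_set [set p : position n | reachable k p].
Proof.
elim: k => [|k IHk].
  apply: (@sub_finite_set _ _ [set empty_board n]); last exact: finite_set1.
  by move=> p /= H; inversion H.
apply: (@sub_finite_set _ _
  (\bigcup_(j in [set: 'I_n])
     (insert (move_color k) j @` [set p : position n | reachable k p]))).
  move=> p /= H; inversion H as [|m q j Hq e1 e2]; subst.
  by exists j => //; exists q.
apply: bigcup_finite; first exact: finite_finset.
by move=> j _; exact: finite_image.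
Qed.

(* fset_set A is the set A as a finite set when A is finite (see
   finite_reachable), and the empty set otherwise. *)
Definition F (n k : nat) : nat :=
  #|` fset_set [set p : position n | reachable k p] |.

(* Main.v *)
(* A reachable position comes from one of the n^k sequences of chosen columns.
   The n(n-1)...(n-k+1) sequences without repetition yield exactly the
   positions given by two disjoint sets of columns (one red token each, one
   yellow token each) of sizes ceil(k/2) and floor(k/2); there are
   n(n-1)...(n-k+1) / (ceil(k/2)! floor(k/2)!) of these.  The sequences with a
   repetition yield at most n^k - n(n-1)...(n-k+1) = o(n^k) further positions. *)
Require Import Defs.
From mathcomp Require Import all_boot all_order all_algebra finmap ring.
From mathcomp Require Import all_classical all_reals all_analysis.
(* Again, so that finset's lemma names shadow those of classical_sets. *)
From mathcomp Require Import finset.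
Import Order.TTheory GRing.Theory Num.Theory.
Import numFieldNormedType.Exports.

(** The head of the list is the last move, so [size s'] counts the moves made before it and fixes
    its color. *)
Fixpoint play {n : nat} (s : seq 'I_n) : position n :=
  if s is j :: s' then insert (move_color (size s')) j (play s')
  else empty_board n.

Lemma reachable_play (n k : nat) (p : position n) :
  reachable k p -> exists t : k.-tuple 'I_n, p = play t.
Proof.
elim=> [|m q j _ [t ->]]; first by exists [tuple].
by exists [tuple of j :: t]; rewrite /= size_tuple.
Qed.

Definition flat_position {n : nat} (TU : {set 'I_n} * {set 'I_n}) : position n :=
  [ffun i => if i \in TU.1 then [:: Red]
             else if i \in TU.2 then [:: Yellow] else [::]].

Definition flat_sets (n k : nat) : {set {set 'I_n} * {set 'I_n}} :=
  [set TU : {set 'I_n} * {set 'I_n} | [disjoint TU.1 & TU.2] &&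
            ((#|TU.1| == uphalf k) && (#|TU.2| == k./2))]%SET.

Lemma flat_setsP (n k : nat) (T U : {set 'I_n}) :
  reflect [/\ [disjoint T & U], #|T| = uphalf k & #|U| = k./2]
          ((T, U) \in flat_sets n k).
Proof.
by rewrite inE /=; apply: (iffP and3P) => -[dTU /eqP ? /eqP ?].
Qed.

(** [T] is read off as the columns holding a red token. The test for [T] masks [U] on any overlap,
    so recovering [U] uses disjointness. *)
Lemma flat_position_inj (n k : nat) :
  {in flat_sets n k &, injective (@flat_position n)}.
Proof.
move=> [T U] [T' U'] /flat_setsP[dTU _ _] /flat_setsP[dTU' _ _] /ffunP e.
have eT : T = T'.
  by apply/setP => i; move: (e i); rewrite !ffunE /=; do 4?case: ifP.
congr (_, _) => //; subst T'.
apply/setP => i; move: (e i); rewrite !ffunE /=.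
case: ifP => [iT _|_]; last by do 2?case: ifP.
by rewrite (disjointFr dTU iT) (disjointFr dTU' iT).
Qed.

Lemma insert_flat_Red (n : nat) (T U : {set 'I_n}) (j : 'I_n) :
  j \notin T -> j \notin U ->
  insert Red j (flat_position (T, U)) = flat_position (j |: T, U).
Proof.
move=> jT jU; apply/ffunP => i; rewrite !ffunE /= in_setU1.
by case: eqP => //= ->; rewrite (negPf jT) (negPf jU).
Qed.

Lemma insert_flat_Yellow (n : nat) (T U : {set 'I_n}) (j : 'I_n) :
  j \notin T -> j \notin U ->
  insert Yellow j (flat_position (T, U)) = flat_position (T, j |: U).
Proof.
move=> jT jU; apply/ffunP => i; rewrite !ffunE /= in_setU1.
by case: eqP => //= ->; rewrite (negPf jT) (negPf jU).
Qed.

(** Induction on [k], undoing a last move: any token of the color of that move can be taken as the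
    last one inserted. *)
Lemma flat_position_reachable (n k : nat) TU :
  TU \in flat_sets n k -> reachable k (flat_position TU).
Proof.
case: TU; elim: k => [|k IHk] T U /flat_setsP[dTU cT cU].
  move: cT cU => /eqP; rewrite cards_eq0 => /eqP -> /eqP.
  rewrite cards_eq0 => /eqP ->.
  suff -> : flat_position (set0, set0) = empty_board n by constructor.
  by apply/ffunP => i; rewrite !ffunE /= !inE.
(* The last move is yellow exactly when [k] is odd; in each case the cardinality of the matching set
   is a successor, so it has an element [j] to remove. *)
move: cT cU; rewrite uphalfE /= uphalf_half; case ok : (odd k) => /= cT cU.
- have /card_gt0P[j jU] : 0 < #|U| by rewrite cU.
  have jT : j \notin T by rewrite (disjointFl dTU jU).
  have -> : flat_position (T, U) =
      insert (move_color k) j (flat_position (T, U :\ j)).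
    by rewrite /move_color ok insert_flat_Yellow ?setD11// setD1K.
  constructor; apply: IHk; apply/flat_setsP; split.
  + by apply: disjointWr dTU; exact: subD1set.
  + by rewrite cT uphalf_half ok.
  + by apply/eqP; rewrite -(eqn_add2l 1) -cU (cardsD1 j U) jU.
- have /card_gt0P[j jT] : 0 < #|T| by rewrite cT.
  have jU : j \notin U by rewrite (disjointFr dTU jT).
  have -> : flat_position (T, U) =
      insert (move_color k) j (flat_position (T :\ j, U)).
    by rewrite /move_color ok insert_flat_Red ?setD11// setD1K.
  constructor; apply: IHk; apply/flat_setsP; split.
  + by apply: disjointWl dTU; exact: subD1set.
  + by apply/eqP; rewrite uphalf_half ok add0n -eqSS -cT (cardsD1 j T) jT.
  + by rewrite cU.
Qed.

(** The equation on [T :|: U] serves the induction: a new column [j] outside [s] is then empty, so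
    the insertion creates a column of height one. *)
Lemma play_uniq (n : nat) (s : seq 'I_n) : uniq s ->
  exists T U, [/\ T :|: U = [set x in s]%SET, (T, U) \in flat_sets n (size s)
    & play s = flat_position (T, U)].
Proof.
elim: s => [_|j s IHs /= /andP[js /IHs[T [U [TUs /flat_setsP[dTU cT cU] ->]]]]].
  exists set0, set0; split.
  - by apply/setP => i; rewrite !inE.
  - by apply/flat_setsP; rewrite !cards0 disjoints_subset sub0set.
  - by apply/ffunP => i; rewrite !ffunE /= !inE.
have /norP[jT jU] : ~~ ((j \in T) || (j \in U)).
  by rewrite -in_setU TUs inE.
rewrite /move_color; case ok : (odd (size s)).
- exists T, (j |: U); split.
  + by rewrite setUCA TUs; apply/setP => i; rewrite !inE.
  + apply/flat_setsP; rewrite cardsU1 jU cU cT /= uphalf_half ok; split => //.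
    by rewrite disjoint_sym disjoints_subset subUset sub1set inE jT
      -disjoints_subset disjoint_sym.
  + by rewrite insert_flat_Yellow.
- exists (j |: T), U; split.
  + by rewrite -setUA TUs; apply/setP => i; rewrite !inE.
  + apply/flat_setsP; rewrite cardsU1 jT cU cT /= uphalf_half ok; split => //.
    by rewrite disjoints_subset subUset sub1set inE jU -disjoints_subset.
  + by rewrite insert_flat_Red.
Qed.

Lemma ffactnD (n a b : nat) : n ^_ (a + b) = n ^_ a * (n - a) ^_ b.
Proof.
elim: b => [|b IHb]; first by rewrite addn0 muln1.
by rewrite addnS !ffactnSr IHb mulnA subnDA.
Qed.

Lemma addn_uphalf_half (k : nat) : uphalf k + k./2 = k.
Proof. by rewrite uphalf_half -addnA addnn odd_double_half. Qed.

(** Choose [T] first, then [U] inside the complement of [T]; the two factorials turn the binomials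
    into falling factorials. *)
Lemma card_flat_sets (n k : nat) :
  #|flat_sets n k| * ((uphalf k)`! * (k./2)`!) = n ^_ k.
Proof.
suff -> : #|flat_sets n k| = 'C(n, uphalf k) * 'C(n - uphalf k, k./2).
  by rewrite mulnACA !bin_ffact -ffactnD addn_uphalf_half.
pose P (T : {set 'I_n}) := #|T| == uphalf k.
pose Q (T U : {set 'I_n}) := [disjoint T & U] && (#|U| == k./2).
rewrite -sum1_card (eq_bigl (fun TU => P TU.1 && Q TU.1 TU.2)) => [|TU].
  rewrite -(pair_big_dep P Q (fun _ _ => 1)) {}/P {}/Q /=.
  rewrite (eq_bigr (fun=> 'C(n - uphalf k, k./2))) => [|T /eqP cT].
    by rewrite sum_nat_cond_const card_draws card_ord.
  have -> : n - uphalf k = #|~: T| by rewrite cardsCs setCK card_ord cT.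
  rewrite -cards_draws -sum1_card; apply: eq_bigl => U.
  by rewrite inE disjoint_sym disjoints_subset.
by rewrite inE andbCA.
Qed.

Lemma leq_flat_F (n k : nat) : #|flat_sets n k| <= F n k.
Proof.
have -> : #|flat_sets n k| = #|` [fset flat_position TU | TU in flat_sets n k]%fset|.
  by rewrite card_in_imfset ?cardE //; exact: flat_position_inj.
apply: fsubset_leq_card; apply/fsubsetP => _ /imfsetP[TU /= TUk ->].
rewrite in_fset_set; last exact: finite_reachable.
exact/mem_set/flat_position_reachable.
Qed.

(** The reachable positions are covered by the flat ones ([B]) and the results of sequences with a
    repetition ([C]). The additive form avoids truncated subtraction. *)
Lemma leq_F (n k : nat) : F n k + n ^_ k <= #|flat_sets n k| + n ^ k.
Proof.
pose A := [set t : k.-tuple 'I_n | uniq t]%SET.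
have cA : #|A| = n ^_ k.
  rewrite -[n in RHS]card_ord -card_uniq_tuples.
  by apply: eq_card => t; rewrite !inE all_predT.
have cAC : #|A| + #|~: A| = n ^ k by rewrite cardsC card_tuple card_ord.
rewrite -cAC -cA addnCA addnC leq_add2l.
pose B := [fset flat_position TU | TU in flat_sets n k]%fset.
pose C := [fset play (t : k.-tuple 'I_n) | t in ~: A]%fset.
apply: (@leq_trans #|` (B `|` C)%fset|).
  apply/fsubset_leq_card/fsubsetP => p.
  rewrite in_fset_set; last exact: finite_reachable.
  rewrite in_fsetU => /set_mem/reachable_play[t ->]; case ut : (uniq t).
    have [T [U [_ TUk ->]]] := play_uniq _ _ ut.
    rewrite size_tuple in TUk.
    by apply/orP; left; apply/imfsetP; exists (T, U).
  by apply/orP; right; apply/imfsetP; exists t => //=; rewrite !inE ut.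
rewrite (leq_trans (leq_card_fsetU _ _))//.
by apply: leq_add; rewrite (leq_trans (leq_imfset_card _ _ _))// cardE.
Qed.

Local Open Scope classical_set_scope.
Local Open Scope ring_scope.

(** Passing from [k] to [k.+1] multiplies the ratio by [1 - k / n], which tends to 1. *)
Lemma cvg_ffact_div_expn (R : realType) (k : nat) :
  (n ^_ k)%:R / n%:R ^+ k @[n --> \oo] --> (1 : R).
Proof.
elim: k => [|k IHk].
  by under eq_fun do rewrite expr0 divr1; exact: cvg_cst.
have inv0 : (n%:R^-1 : R) @[n --> \oo] --> (0 : R).
  apply: (gtr0_cvgV0 _).2 cvgr_idn.
  by near=> n; rewrite ltr0n; near: n; exact: nbhs_infty_gt.
have lim1 : 1 - k%:R * n%:R^-1 @[n --> \oo] --> (1 : R).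
  rewrite -[X in _ --> X]subr0 -[X in _ --> _ - X](mulr0 k%:R).
  by apply: cvgB; [exact: cvg_cst|apply: cvgM => //; exact: cvg_cst].
rewrite -[X in _ --> X]mulr1; apply: cvg_trans (cvgM IHk lim1).
apply: near_eq_cvg; near=> n.
have n0 : n%:R != 0 :> R.
  by rewrite pnatr_eq0 -lt0n; near: n; exact: nbhs_infty_gt.
(* Below [k] the natural subtraction [n - k] truncates and does not match the real one. *)
have kn : (k <= n)%N by near: n; exact: nbhs_infty_ge.
rewrite /= ffactnSr natrM natrB// exprSr.
by field; rewrite n0 expf_neq0.
Unshelve. all: by end_near. Qed.

(* uphalf k and k./2 are the ceiling and the floor of k/2. *)
Theorem corollary6 (R : realType) (k : nat) :
  ((fun n : nat =>
      (F n k)%:R / ((k`!)%:R^-1 * 'C(k, uphalf k)%:R * n%:R ^+ k) : R)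
     @ \oo --> (1 : R))
  /\ (forall n : nat,
        (k`!)%:R^-1 * 'C(k, uphalf k)%:R * n%:R ^+ k =
        ((uphalf k)`!%:R * (k./2)`!%:R)^-1 * n%:R ^+ k :> R).
Proof.
set c := (uphalf k)`!%:R * (k./2)`!%:R : R.
have fact0 m : m`!%:R != 0 :> R by rewrite pnatr_eq0 -lt0n fact_gt0.
have c0 : c != 0 by rewrite mulf_neq0.
have coefE : (k`!)%:R^-1 * 'C(k, uphalf k)%:R = c^-1 :> R.
  have kE : (k - uphalf k)%N = k./2 by rewrite -{1}(addn_uphalf_half k) addKn.
  have uk : (uphalf k <= k)%N by rewrite -{2}(addn_uphalf_half k) leq_addr.
  have := bin_fact uk; rewrite kE => /(congr1 (GRing.natmul (1 : R))).
  rewrite !natrM -/c => <-.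
  have b0 : 'C(k, uphalf k)%:R != 0 :> R by rewrite pnatr_eq0 -lt0n bin_gt0.
  by field; rewrite c0 b0.
split=> [|n]; last by rewrite coefE.
under eq_fun do rewrite coefE.
pose r n : R := (n ^_ k)%:R / n%:R ^+ k.
have r1 : r n @[n --> \oo] --> (1 : R) := cvg_ffact_div_expn R k.
(* This upper bound is [leq_F] multiplied by [c / n ^ k], where [c] times the number of flat
   positions is [n ^_ k]. *)
have upper1 : r n + c * (1 - r n) @[n --> \oo] --> (1 : R).
  rewrite -[X in _ --> X]addr0 -[X in _ --> _ + X](mulr0 c) -(subrr 1).
  apply: cvgD => //; apply: cvgM; first exact: cvg_cst.
  by apply: cvgB => //; exact: cvg_cst.
apply: squeeze_cvgr r1 upper1.
near=> n.
have n0 : 0 < n%:R ^+ k :> R.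
  by rewrite exprn_gt0// ltr0n; near: n; exact: nbhs_infty_gt.
have cgt0 : 0 < c by rewrite mulr_gt0// ltr0n fact_gt0.
have flatE : (n ^_ k)%:R = c * #|flat_sets n k|%:R :> R.
  by rewrite -card_flat_sets !natrM mulrC.
have -> : (F n k)%:R / (c^-1 * n%:R ^+ k) = c * (F n k)%:R / n%:R ^+ k.
  by field; rewrite c0 gt_eqF.
have -> : r n + c * (1 - r n) =
    ((n ^_ k)%:R + c * (n%:R ^+ k - (n ^_ k)%:R)) / n%:R ^+ k.
  by rewrite /r; field; rewrite gt_eqF.
(* The third [n ^_ k], already multiplied by [c], is left alone so that [c] factors out of both
   bounds. *)
rewrite !ler_pM2r ?invr_gt0// {1 2}flatE -mulrDr !ler_pM2l// ler_nat leq_flat_F.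
by rewrite addrA lerBrDr -natrX -!natrD ler_nat leq_F.
Unshelve. all: by end_near. Qed.
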